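(* Let $\mathcal{Q}$ be a seminormal quasi-crystal with underlying set $Q$ and $\mathcal{M}$ a nondegenerate quasi-crystal monoid of the same type with underlying set $M$. Then for each quasi-crystal homomorphism $\psi:\mathcal{Q}\to\mathcal{M}$ satisfying $\psi(Q)\subseteq M$, there exists a unique quasi-crystal monoid homomorphism $\hat{\psi}:\mathcal{Q}^{*}\to\mathcal{M}$ such that $\hat{\psi}(x)=\psi(x)$ for all $x\in Q$.
   Context: Root system data: $V$ a finite-dimensional real inner product space, $\alpha^\vee=\frac{2}{\langle\alpha,\alpha\rangle}\alpha$; a root system $\Phi$ with fixed simple roots $(\alpha_i)_{i\in I}$ and weight lattice $\Lambda$ (a $\mathbb{Z}$-submodule of $V$ spanning $V$, containing $\Phi$, with $\langle\lambda,\alpha^\vee\rangle\in\mathbb{Z}$ for $\alpha\in\Phi$). A quasi-crystal of type $\Phi$ is a set $Q$ with maps $\mathrm{wt}:Q\to\Lambda$, $\ddot{e}_i,\ddot{f}_i:Q\to Q\sqcup\{\bot\}$ ($\bot$ = undefined), $\ddot{\varepsilon}_i,\ddot{\varphi}_i:Q\to\mathbb{Z}\cup\{\pm\infty\}$ ($i\in I$) such that: $\ddot{\varphi}_i(x)=\ddot{\varepsilon}_i(x)+\langle\mathrm{wt}(x),\alpha_i^\vee\rangle$ (with $m+(\pm\infty)=\pm\infty$); if $\ddot{e}_i(x)\in Q$ then $\mathrm{wt}(\ddot{e}_i(x))=\mathrm{wt}(x)+\alpha_i$, $\ddot{\varepsilon}_i(\ddot{e}_i(x))=\ddot{\varepsilon}_i(x)-1$,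 $\ddot{\varphi}_i(\ddot{e}_i(x))=\ddot{\varphi}_i(x)+1$; if $\ddot{f}_i(x)\in Q$ then $\mathrm{wt}(\ddot{f}_i(x))=\mathrm{wt}(x)-\alpha_i$, $\ddot{\varepsilon}_i(\ddot{f}_i(x))=\ddot{\varepsilon}_i(x)+1$, $\ddot{\varphi}_i(\ddot{f}_i(x))=\ddot{\varphi}_i(x)-1$; $\ddot{e}_i(x)=y\iff x=\ddot{f}_i(y)$; $\ddot{\varepsilon}_i(x)=\pm\infty$ implies $\ddot{e}_i(x)=\ddot{f}_i(x)=\bot$. Seminormal: whenever $\ddot{\varepsilon}_i(x)\ne+\infty$, $\ddot{\varepsilon}_i(x)=\max\{k\ge0:\ddot{e}_i^k(x)\in Q\}$ and $\ddot{\varphi}_i(x)=\max\{k\ge0:\ddot{f}_i^k(x)\in Q\}$. Quasi-crystal homomorphism $\psi:\mathcal{Q}\to\mathcal{Q}'$: a map $Q\sqcup\{\bot\}\to Q'\sqcup\{\bot\}$, $\psi(\bot)=\bot$, such that whenever $\psi(x)\in Q'$ it has the same $\mathrm{wt},\ddot{\varepsilon}_i,\ddot{\varphi}_i$ as $x$, and $\psi(\ddot{e}_i(x))=\ddot{e}_i(\psi(x))$ (resp. same for $\ddot{f}_i$) whenever $\ddot{e}_i(x)\in Q$ and $\psi(x),\psi(\ddot{e}_i(x))\in Q'$. A map $Q\to Q'$ is regarded as such with $\bot\mapsto\bot$. Quasi-tensor product of seminormal $\mathcal{Q},\mathcal{Q}'$: set $Q\times Q'$ (elements $x\ddot{\otimes}x'$),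 $\mathrm{wt}(x\ddot{\otimes}x')=\mathrm{wt}(x)+\mathrm{wt}(x')$; for $i\in I$: if $\ddot{\varphi}_i(x)>0$ and $\ddot{\varepsilon}_i(x')>0$ then $\ddot{e}_i,\ddot{f}_i$ undefined and $\ddot{\varepsilon}_i=\ddot{\varphi}_i=+\infty$ on $x\ddot{\otimes}x'$; otherwise $\ddot{e}_i(x\ddot{\otimes}x')=\ddot{e}_i(x)\ddot{\otimes}x'$ if $\ddot{\varphi}_i(x)\ge\ddot{\varepsilon}_i(x')$, else $x\ddot{\otimes}\ddot{e}_i(x')$; $\ddot{f}_i(x\ddot{\otimes}x')=\ddot{f}_i(x)\ddot{\otimes}x'$ if $\ddot{\varphi}_i(x)>\ddot{\varepsilon}_i(x')$, else $x\ddot{\otimes}\ddot{f}_i(x')$ (with $\bot$ absorbing); $\ddot{\varepsilon}_i(x\ddot{\otimes}x')=\max\{\ddot{\varepsilon}_i(x),\ddot{\varepsilon}_i(x')-\langle\mathrm{wt}(x),\alpha_i^\vee\rangle\}$, $\ddot{\varphi}_i(x\ddot{\otimes}x')=\max\{\ddot{\varphi}_i(x)+\langle\mathrm{wt}(x'),\alpha_i^\vee\rangle,\ddot{\varphi}_i(x')\}$. A quasi-crystal monoid is a seminormal quasi-crystal $\mathcal{M}$ whose underlying set $M$ is also a monoid such that $x\ddot{\otimes}y\mapsto xy$ is a quasi-crystal homomorphism $\mathcal{M}\ddot{\otimes}\mathcal{M}\to\mathcal{M}$. It is nondegenerate if $\ddot{\varepsilon}_i(1)=\ddot{\varphi}_i(1)=0$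 for all $i\in I$. A quasi-crystal monoid homomorphism is a map $M\to M'$ that is both a quasi-crystal homomorphism and a monoid homomorphism. The free quasi-crystal monoid $\mathcal{Q}^{*}$: the free monoid $Q^*$ of words over $Q$ with: for the empty word, $\mathrm{wt}=0$, $\ddot{\varepsilon}_i=\ddot{\varphi}_i=0$, $\ddot{e}_i,\ddot{f}_i$ undefined; for $w=x_1\cdots x_m$ ($x_k\in Q$, $m\ge1$), $\mathrm{wt}(w)=\sum_k\mathrm{wt}(x_k)$, and for $i\in I$ with $p=\max\{k:\ddot{\varepsilon}_i(x_k)>0\}$ and $q=\min\{l:\ddot{\varphi}_i(x_l)>0\}$: if some $\ddot{\varepsilon}_i(x_k)=+\infty$, or both $p,q$ exist with $p>q$, then $\ddot{\varepsilon}_i(w)=\ddot{\varphi}_i(w)=+\infty$ and $\ddot{e}_i(w),\ddot{f}_i(w)$ are undefined; otherwise $\ddot{\varepsilon}_i(w)=\sum_k\ddot{\varepsilon}_i(x_k)$, $\ddot{\varphi}_i(w)=\sum_k\ddot{\varphi}_i(x_k)$, $\ddot{e}_i(w)$ is defined iff $p$ exists and then is $w$ with $x_p$ replaced by $\ddot{e}_i(x_p)$, and $\ddot{f}_i(w)$ is defined iff $q$ exists and then is $w$ with $x_q$ replaced by $\ddot{f}_i(x_q)$. This is a quasi-crystal monoid. *)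

(* Defs.v *)
From HB Require Import structures.
From mathcomp Require Import all_boot all_order all_algebra.
From mathcomp Require Import sesquilinear.
From mathcomp Require Import boolp classical_sets cardinality reals.
From mathcomp Require Import constructive_ereal.

Set Implicit Arguments.
Unset Strict Implicit.
Unset Printing Implicit Defensive.

Import Order.TTheory GRing.Theory Num.Theory.
Local Open Scope ring_scope.

Section RootSystems.
Context (R : realType) (V : vectType R) (dot : {dot V for idfun}).

Definition coroot (a : V) : V := (2 / dot a a) *: a.

Definition reflection (a v : V) : V := v - dot v (coroot a) *: a.

(* Roots are not required to span V. *)
Record is_root_system (Phi : set V) : Prop := IsRootSystem {
  roots_finite : finite_set Phi;
  roots_neq0 : ~ Phi 0;
  roots_reduced : forall (a : V) (k : R),
    Phi a -> Phi (k *: a) -> k = 1 \/ k = -1;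
  roots_reflection : forall a b : V,
    Phi a -> Phi b -> Phi (reflection a b);
  roots_integral : forall a b : V,
    Phi a -> Phi b -> dot a (coroot b) \is a Num.int
}.

Record are_simple_roots (Phi : set V) (I : finType) (alpha : I -> V) : Prop :=
  AreSimpleRoots {
  simple_root : forall i, Phi (alpha i);
  simple_free : free (codom alpha);
  simple_decomp : forall b : V, Phi b -> exists c : I -> nat,
    b = \sum_i (c i)%:R *: alpha i \/ b = - \sum_i (c i)%:R *: alpha i
}.

Record is_weight_lattice (Phi Lambda : set V) : Prop := IsWeightLattice {
  lattice0 : Lambda 0;
  latticeB : forall v w : V, Lambda v -> Lambda w -> Lambda (v - w);
  lattice_span : exists s : seq V,
    (forall v, v \in s -> Lambda v) /\ <<s>>%VS = fullv;
  lattice_roots : forall a, Phi a -> Lambda a;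
  lattice_integral : forall v a : V,
    Lambda v -> Phi a -> dot v (coroot a) \is a Num.int
}.

End RootSystems.

Record root_data (R : realType) := RootData {
  ambient : vectType R;
  dotp : {dot ambient for idfun};
  roots : set ambient;
  idx : finType;
  alpha : idx -> ambient;
  weights : set ambient;
  rootsP : is_root_system dotp roots;
  alphaP : are_simple_roots roots alpha;
  weightsP : is_weight_lattice dotp roots weights
}.

(* The integer <v, alpha_i^vee>: on the weight lattice the pairing is integral,
   so the floor only changes its type from R to int. *)
Definition pairing (R : realType) (D : root_data R)
    (v : ambient D) (i : idx D) : int :=
  Num.floor (dotp D v (coroot (dotp D) (alpha i))).

Section QuasiCrystals.
Context (R : realType) (D : root_data R).

Local Notation V := (ambient D).
Local Notation I := (idx D).

(* [None] is the undefined element, and [\bar int] is int with both infinities. *)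
Record qc_ops (Q : Type) := QcOps {
  wt : Q -> V;
  e_ : I -> Q -> option Q;
  f_ : I -> Q -> option Q;
  eps : I -> Q -> \bar int;
  phi : I -> Q -> \bar int
}.

Record is_quasicrystal (Q : Type) (C : qc_ops Q) : Prop := IsQuasicrystal {
  qc_wt : forall x, weights (wt C x);
  qc_phi : forall i x, phi C i x = (eps C i x + (pairing (wt C x) i)%:E)%E;
  qc_e : forall i x y, e_ C i x = Some y ->
    [/\ wt C y = wt C x + alpha i,
        eps C i y = (eps C i x - 1)%E &
        phi C i y = (phi C i x + 1)%E];
  qc_f : forall i x y, f_ C i x = Some y ->
    [/\ wt C y = wt C x - alpha i,
        eps C i y = (eps C i x + 1)%E &
        phi C i y = (phi C i x - 1)%E];
  qc_ef : forall i x y, e_ C i x = Some y <-> f_ C i y = Some x;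
  qc_infinite : forall i x, eps C i x = +oo%E \/ eps C i x = -oo%E ->
    e_ C i x = None /\ f_ C i x = None
}.

Definition iter_defined (Q : Type) (g : Q -> option Q) (x : Q) (k : nat) : Prop :=
  iter k (obind g) (Some x) <> None.

Definition is_max (P : nat -> Prop) (z : \bar int) : Prop :=
  exists k : nat,
    [/\ z = (k%:Z)%:E, P k & forall m : nat, P m -> (m <= k)%N].

Definition seminormal (Q : Type) (C : qc_ops Q) : Prop :=
  forall i x, eps C i x <> +oo%E ->
    is_max (iter_defined (e_ C i) x) (eps C i x) /\
    is_max (iter_defined (f_ C i) x) (phi C i x).

Definition is_qc_hom (Q Q' : Type) (C : qc_ops Q) (C' : qc_ops Q')
    (psi : option Q -> option Q') : Prop :=
  [/\ psi None = None,
      forall x x', psi (Some x) = Some x' ->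
        wt C' x' = wt C x /\
        forall i, eps C' i x' = eps C i x /\ phi C' i x' = phi C i x,
      forall i x y x' y', e_ C i x = Some y ->
        psi (Some x) = Some x' -> psi (Some y) = Some y' ->
        psi (e_ C i x) = e_ C' i x' &
      forall i x y x' y', f_ C i x = Some y ->
        psi (Some x) = Some x' -> psi (Some y) = Some y' ->
        psi (f_ C i x) = f_ C' i x'].

Section Tensor.
Context (Q Q' : Type) (C : qc_ops Q) (C' : qc_ops Q').

Definition tensor_blocked (i : I) (p : Q * Q') : bool :=
  ((0 < phi C i p.1) && (0 < eps C' i p.2))%E.

Definition qtensor : qc_ops (Q * Q')%type := {|
  wt p := wt C p.1 + wt C' p.2;
  e_ i p :=
    if tensor_blocked i p then None
    else if (eps C' i p.2 <= phi C i p.1)%E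
         then omap (fun y => (y, p.2)) (e_ C i p.1)
         else omap (fun y => (p.1, y)) (e_ C' i p.2);
  f_ i p :=
    if tensor_blocked i p then None
    else if (eps C' i p.2 < phi C i p.1)%E
         then omap (fun y => (y, p.2)) (f_ C i p.1)
         else omap (fun y => (p.1, y)) (f_ C' i p.2);
  eps i p :=
    if tensor_blocked i p then +oo%E
    else Order.max (eps C i p.1) (eps C' i p.2 - (pairing (wt C p.1) i)%:E)%E;
  phi i p :=
    if tensor_blocked i p then +oo%E
    else Order.max (phi C i p.1 + (pairing (wt C' p.2) i)%:E)%E (phi C' i p.2)
|}.

End Tensor.

Definition is_qc_monoid (M : monoidType) (C : qc_ops M) : Prop :=
  [/\ is_quasicrystal C, seminormal C &
      is_qc_hom (qtensor C C) C (omap (fun p : M * M => (p.1 * p.2)%g))].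

Definition nondegenerate_qc (M : monoidType) (C : qc_ops M) : Prop :=
  forall i, eps C i 1%g = 0%E /\ phi C i 1%g = 0%E.

Definition is_qc_monoid_hom (M M' : monoidType) (C : qc_ops M) (C' : qc_ops M')
    (h : M -> M') : Prop :=
  is_qc_hom C C' (omap h) /\ monoid.monoid_morphism h.

End QuasiCrystals.

Definition word (Q : choiceType) : Type := seq Q.

HB.instance Definition _ (Q : choiceType) := Choice.on (word Q).
HB.instance Definition _ (Q : choiceType) :=
  isMonoid.Build (word Q) (@catA Q) (@cat0s Q) (@cats0 Q).

Definition letter (Q : choiceType) (x : Q) : word Q := [:: x].

Section FreeQuasiCrystalMonoid.
Context (R : realType) (D : root_data R) (Q : choiceType) (C : qc_ops D Q).

(* Positions are counted from 0. *)
Definition first_pos (a : pred Q) (w : seq Q) : option nat :=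
  if has a w then Some (find a w) else None.

Definition last_pos (a : pred Q) (w : seq Q) : option nat :=
  if has a w then Some (size w - (find a (rev w)).+1)%N else None.

(* [w] with its letter [x] at position [k] replaced by [g x], undefined when
   [g x] is. *)
Definition replace_at (g : Q -> option Q) (w : seq Q) (k : nat) : option (seq Q) :=
  obind (fun x => omap (fun y => set_nth y w k y) (g x)) (onth w k).

Definition last_eps (i : idx D) : seq Q -> option nat :=
  last_pos (fun x => 0 < eps C i x)%E.

Definition first_phi (i : idx D) : seq Q -> option nat :=
  first_pos (fun x => 0 < phi C i x)%E.

Definition word_blocked (i : idx D) (w : seq Q) : bool :=
  has (fun x => eps C i x == +oo%E) w ||
  (if (last_eps i w, first_phi i w) is (Some p, Some q) then (q < p)%N
   else false).

(* On the empty word, these formulas give weight 0, eps = phi = 0, and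
   undefined operators. *)
Definition free_qc : qc_ops D (word Q) := {|
  wt w := \sum_(x <- w) wt C x;
  e_ i w :=
    if word_blocked i w then None
    else obind (replace_at (e_ C i) w) (last_eps i w);
  f_ i w :=
    if word_blocked i w then None
    else obind (replace_at (f_ C i) w) (first_phi i w);
  eps i w :=
    if word_blocked i w then +oo%E else (\sum_(x <- w) eps C i x)%E;
  phi i w :=
    if word_blocked i w then +oo%E else (\sum_(x <- w) phi C i x)%E
|}.

End FreeQuasiCrystalMonoid.

(* Main.v *)
Require Import Defs.
From mathcomp Require Import all_boot all_order all_algebra.
From mathcomp Require Import reals.
From mathcomp Require Import boolp constructive_ereal zify.

(** On nonempty words the free quasi-crystal monoid satisfies Q* = Q (x) Q*: the
    operators, eps and phi of x :: w are those of the quasi-tensor x (x) w.  The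
    extension of psi sends a word to the product of the images of its letters.
    By induction on the word, it is compatible with the structure because psi
    and the multiplication N (x) N -> N are; nondegeneracy of N is the case of
    the empty word. *)

Set Implicit Arguments.
Unset Strict Implicit.
Unset Printing Implicit Defensive.

Import Order.TTheory GRing.Theory Num.Theory.
Local Open Scope ring_scope.

(** * String lengths in a seminormal quasi-crystal *)

(** If [eps] is not [+oo], seminormality makes [eps] and [phi] maxima of sets of naturals, which
    also excludes [-oo]; the pairing is then their difference. *)
Lemma qc_string_lengths (R : realType) (D : root_data R) (Q : Type)
    (C : qc_ops D Q) (i : idx D) (x : Q) :
  is_quasicrystal C -> seminormal C ->
  (eps C i x = +oo /\ phi C i x = +oo)%E \/
  exists a b : nat, [/\ eps C i x = (a%:Z)%:E, phi C i x = (b%:Z)%:E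
                      & pairing (wt C x) i = b%:Z - a%:Z].
Proof.
move=> qC nC; have phiE := qc_phi qC i x.
have [eoo|/eqP efin] := eqVneq (eps C i x) +oo%E.
  by left; split => //; rewrite phiE eoo.
right; have [[a [ea _ _]] [b [pb _ _]]] := nC i x efin.
exists a, b; split => //.
by move: phiE; rewrite ea pb => -[->]; rewrite addrC addrK.
Qed.

Section SeminormalQuasiCrystal.
Context (R : realType) (D : root_data R) (Q : Type) (C : qc_ops D Q).
Hypotheses (qC : is_quasicrystal C) (nC : seminormal C).

Lemma qc_eps_ge0 i x : (0 <= eps C i x)%E.
Proof. by have [[-> _]|[a [b [-> _ _]]]] := qc_string_lengths i x qC nC. Qed.

Lemma qc_phi_ge0 i x : (0 <= phi C i x)%E.
Proof. by have [[_ ->]|[a [b [_ -> _]]]] := qc_string_lengths i x qC nC. Qed.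

Lemma qc_phi_oo i x : (phi C i x == +oo)%E = (eps C i x == +oo)%E.
Proof. by have [[-> ->]|[a [b [-> -> _]]]] := qc_string_lengths i x qC nC. Qed.

(** Applying [e_] lowers [eps] by 1, and the result is still nonnegative. *)
Lemma qc_e_eps_gt0 i x y : e_ C i x = Some y -> (0 < eps C i x)%E.
Proof.
move=> /(qc_e qC)[_ ey _]; move: (qc_eps_ge0 i y); rewrite ey.
have [[-> _]|[a [b [-> _ _]]]] // := qc_string_lengths i x qC nC.
by rewrite -EFinB lee_fin lte_fin; lia.
Qed.

Lemma qc_f_phi_gt0 i x y : f_ C i x = Some y -> (0 < phi C i x)%E.
Proof.
move=> /(qc_f qC)[_ _ py]; move: (qc_phi_ge0 i y); rewrite py.
have [[_ ->]|[a [b [_ -> _]]]] // := qc_string_lengths i x qC nC.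
by rewrite -EFinB lee_fin lte_fin; lia.
Qed.

End SeminormalQuasiCrystal.

(** * The quasi-tensor product in terms of signs and sums *)

Section QuasiTensor.
Context (R : realType) (D : root_data R) (Q Q' : Type).
Context (C : qc_ops D Q) (C' : qc_ops D Q').

(** Outside the blocked case, [phi x >= 0] reduces the comparison of [eps y] with [phi x] to the
    sign of [eps y]. *)
Lemma qtensor_eE i x y : (0 <= phi C i x)%E ->
  e_ (qtensor C C') i (x, y) =
    if (0 < eps C' i y)%E then
      if (0 < phi C i x)%E then None else omap (pair x) (e_ C' i y)
    else omap (fun z => (z, y)) (e_ C i x).
Proof.
move=> phi0; rewrite /= /tensor_blocked /= andbC.
case: (ltP 0%E (eps C' i y)) => [eps0|eps0] /=.
  case: (ltP 0%E (phi C i x)) => // phi0'.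
  by rewrite leNgt (le_lt_trans phi0' eps0).
by rewrite (le_trans eps0 phi0).
Qed.

Lemma qtensor_fE i x y : (0 <= eps C' i y)%E ->
  f_ (qtensor C C') i (x, y) =
    if (0 < phi C i x)%E then
      if (0 < eps C' i y)%E then None else omap (fun z => (z, y)) (f_ C i x)
    else omap (pair x) (f_ C' i y).
Proof.
move=> eps0; rewrite /= /tensor_blocked /=.
case: (ltP 0%E (phi C i x)) => [phi0|phi0] /=.
  case: (ltP 0%E (eps C' i y)) => // eps0'.
  by rewrite (le_lt_trans eps0' phi0).
by rewrite ltNge (le_trans phi0 eps0).
Qed.

Hypotheses (qC : is_quasicrystal C) (nC : seminormal C).
Hypotheses (qC' : is_quasicrystal C') (nC' : seminormal C').

(** For finite values the maximum is that of [eps x] and [eps x + eps y - phi x]. Unblocked means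
    [phi x = 0] or [eps y = 0], and in both cases the maximum is the sum. *)
Lemma qtensor_epsE i x y :
  eps (qtensor C C') i (x, y) =
    if tensor_blocked C C' i (x, y) then +oo%E
    else (eps C i x + eps C' i y)%E.
Proof.
rewrite /= /tensor_blocked /=; case: ifP => //.
have [[-> ->]|[a [b [-> -> ->]]]] := qc_string_lengths i x qC nC;
have [[-> _]|[c [d [-> _ _]]]] := qc_string_lengths i y qC' nC' => //=.
  by rewrite !lte_fin -EFinB -EFin_max -EFinD => bl; congr EFin; lia.
Qed.

Lemma qtensor_phiE i x y :
  phi (qtensor C C') i (x, y) =
    if tensor_blocked C C' i (x, y) then +oo%E
    else (phi C i x + phi C' i y)%E.
Proof.
rewrite /= /tensor_blocked /=; case: ifP => //.
have [[_ ->]|[a [b [_ -> _]]]] := qc_string_lengths i x qC nC;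
have [[-> ->]|[c [d [-> -> ->]]]] := qc_string_lengths i y qC' nC' => //=.
  by rewrite -EFinD maxey.
by rewrite !lte_fin -!EFinD -EFin_max => bl; congr EFin; lia.
Qed.

End QuasiTensor.

(** * Words as quasi-tensors of the head letter and the tail *)

Section FreeCons.
Context (R : realType) (D : root_data R) (Q : choiceType) (C : qc_ops D Q).
Hypotheses (qC : is_quasicrystal C) (nC : seminormal C).

Lemma first_pos_cons (a : pred Q) x w :
  first_pos a (x :: w) = if a x then Some 0%N else omap S (first_pos a w).
Proof. by rewrite /first_pos /=; case: (a x) => //=; case: (has a w). Qed.

Lemma last_pos_cons (a : pred Q) x w :
  last_pos a (x :: w) =
    if has a w then omap S (last_pos a w) else if a x then Some 0%N else None.
Proof.
(* Reversal puts [x] last, so the search meets all of [w] first. *)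
rewrite /last_pos /= rev_cons -cats1 find_cat has_rev size_rev.
case hw: (has a w); rewrite ?orbT ?orbF //=.
  move: hw; rewrite -has_rev has_find size_rev => fw.
  by rewrite subSS -subSn.
by case: (a x) => //=; rewrite addn0 subSS subnn.
Qed.

Lemma replace_at0 (g : Q -> option Q) x w :
  replace_at g (x :: w) 0 = omap (cons^~ w) (g x).
Proof. by []. Qed.

Lemma replace_atS (g : Q -> option Q) x w k :
  replace_at g (x :: w) k.+1 = omap (cons x) (replace_at g w k).
Proof. by rewrite /replace_at /=; case: (onth w k) => //= y; case: (g y). Qed.

(** The head has position 0, below all positions of [w]: it adds an inversion [q < p] exactly when
    it supplies [q] and [w] supplies [p]. *)
Lemma word_blocked_cons i x w :
  word_blocked C i (x :: w) =
    [|| eps C i x == +oo%E, word_blocked C i w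
      | (0 < phi C i x)%E && has (fun y => 0 < eps C i y)%E w].
Proof.
rewrite /word_blocked /last_eps /first_phi /= last_pos_cons first_pos_cons.
rewrite -!orbA; do 2![congr (_ || _)].
have: isSome (last_pos (fun y => 0 < eps C i y)%E w)
       = has (fun y => 0 < eps C i y)%E w by rewrite /last_pos; case: ifP.
case: (has _ w) (last_pos _ w) => [] [p|] //= _; last first.
  by case: (0 < eps C i x)%E; case: (0 < phi C i x)%E;
    case: (first_pos (fun y => 0 < phi C i y)%E w).
by case: (0 < phi C i x)%E; rewrite ?orbT ?orbF;
  case: (first_pos (fun y => 0 < phi C i y)%E w).
Qed.

Lemma sum_eps_gt0 i w :
  (0 < \sum_(x <- w) eps C i x)%E = has (fun x => 0 < eps C i x)%E w.
Proof.
elim: w => [|x w IHw]; rewrite ?big_nil ?big_cons //= -IHw.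
have e0 := qc_eps_ge0 qC nC i x.
have s0 : (0 <= \sum_(y <- w) eps C i y)%E.
  by apply: sume_ge0 => y _; exact: qc_eps_ge0.
case: (ltP 0%E (eps C i x)) => /= [ex|ex].
  exact: (lt_le_trans ex (leeDl _ s0)).
by rewrite (@le_anti _ _ (eps C i x) 0%E) ?ex ?e0 // add0e.
Qed.

Lemma free_eps_gt0 i w :
  (0 < eps (free_qc C) i w)%E =
    word_blocked C i w || has (fun x => 0 < eps C i x)%E w.
Proof. by rewrite /=; case: ifP => //= _; exact: sum_eps_gt0. Qed.

Lemma free_eps_ge0 i w : (0 <= eps (free_qc C) i w)%E.
Proof.
by rewrite /=; case: ifP => // _; apply: sume_ge0 => x _; exact: qc_eps_ge0.
Qed.

Lemma free_blocked_cons i x w : word_blocked C i (x :: w) =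
  [|| eps C i x == +oo%E, word_blocked C i w
    | tensor_blocked C (free_qc C) i (x, w)].
Proof.
rewrite word_blocked_cons /tensor_blocked /fst /snd free_eps_gt0.
(* A blocked [w] has [eps = +oo], so [tensor_blocked] may hold for that reason too; the second
   disjunct absorbs this case. *)
by case: (word_blocked C i w); rewrite ?orbT.
Qed.

(** The other two causes of blocking, [eps x = +oo] and a blocked [w], already make the sum [+oo],
    since no summand is [-oo]. *)
Lemma free_eps_cons i x w : eps (free_qc C) i (x :: w) =
  if tensor_blocked C (free_qc C) i (x, w) then +oo%E
  else (eps C i x + eps (free_qc C) i w)%E.
Proof.
rewrite {1}/eps /= free_blocked_cons big_cons.
case: (tensor_blocked _ _ _ _); rewrite ?orbT ?orbF //.
have [->|/= _] := eqVneq (eps C i x) +oo%E; last case: ifP => //= _.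
  by rewrite /= addye // -ltNye (lt_le_trans _ (free_eps_ge0 i w)).
by rewrite addey // -ltNye (lt_le_trans _ (qc_eps_ge0 qC nC i x)).
Qed.

Lemma free_phi_cons i x w : phi (free_qc C) i (x :: w) =
  if tensor_blocked C (free_qc C) i (x, w) then +oo%E
  else (phi C i x + phi (free_qc C) i w)%E.
Proof.
have p0 : (0 <= phi (free_qc C) i w)%E.
  by rewrite /=; case: ifP => // _; apply: sume_ge0 => y _; exact: qc_phi_ge0.
rewrite {1}/phi /= free_blocked_cons big_cons -(qc_phi_oo qC nC).
case: (tensor_blocked _ _ _ _); rewrite ?orbT ?orbF //.
have [->|/= _] := eqVneq (phi C i x) +oo%E; last case: ifP => //= _.
  by rewrite /= addye // -ltNye (lt_le_trans _ p0).
by rewrite addey // -ltNye (lt_le_trans _ (qc_phi_ge0 qC nC i x)).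
Qed.

(** The last letter with positive [eps] lies in [w] if [w] has any such letter, and otherwise can
    only be [x]; the sign of [eps w] makes the same choice in the tensor. *)
Lemma free_e_cons i x w : e_ (free_qc C) i (x :: w) =
  omap (fun p => p.1 :: p.2) (e_ (qtensor C (free_qc C)) i (x, w)).
Proof.
rewrite qtensor_eE ?qc_phi_ge0 // free_eps_gt0 /= word_blocked_cons.
rewrite /last_eps last_pos_cons -(qc_phi_oo qC nC).
case: (word_blocked C i w) => /=; first by rewrite orbT; case: ifP.
case: (has _ w) => /=.
  rewrite andbT; case: (ltP 0%E (phi C i x)) => [_|px] /=; rewrite ?orbT //.
  rewrite orbF; case: eqP px => [-> //|_ _].
  by case: (last_pos _ w) => //= p;
     rewrite replace_atS; case: (replace_at _ w p).
(* If [phi x = +oo], the word is blocked; then [eps x = +oo] too, so [e_] is undefined at [x]. *)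
rewrite andbF orbF; case: eqP => [/eqP|_].
  rewrite (qc_phi_oo qC nC) => /eqP eoo.
  by have [-> _] := qc_infinite qC (or_introl eoo).
case ex: (e_ C i x) => [y|]; last by case: ifP; rewrite //= replace_at0 ex.
by rewrite (qc_e_eps_gt0 qC nC ex) /= replace_at0 ex.
Qed.

(** Here the head takes precedence: it is the first letter with positive [phi] as soon as
    [phi x > 0]. *)
Lemma free_f_cons i x w : f_ (free_qc C) i (x :: w) =
  omap (fun p => p.1 :: p.2) (f_ (qtensor C (free_qc C)) i (x, w)).
Proof.
rewrite qtensor_fE ?free_eps_ge0 // free_eps_gt0 /= word_blocked_cons.
rewrite /first_phi first_pos_cons -(qc_phi_oo qC nC).
case: (ltP 0%E (phi C i x)) => [_|px] /=.
  case: (word_blocked C i w || _); rewrite ?orbT //= orbF.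
  case: eqP => [/eqP|_]; last by rewrite replace_at0; case: (f_ C i x).
  rewrite (qc_phi_oo qC nC) => /eqP eoo.
  by have [_ ->] := qc_infinite qC (or_introl eoo).
rewrite orbF; case: eqP px => [-> //|_ _] /=.
case: (word_blocked C i w) => //.
by case: (first_pos _ w) => //= q;
   rewrite replace_atS; case: (replace_at _ w q).
Qed.

End FreeCons.

(** * The extension to words is a homomorphism *)

Section Extension.
Context (R : realType) (D : root_data R).
Context (Q : choiceType) (C : qc_ops D Q) (M : monoidType) (N : qc_ops D M).
Hypotheses (qC : is_quasicrystal C) (nC : seminormal C).
Hypotheses (mN : is_qc_monoid N) (N1 : nondegenerate_qc N).
Context (g : Q -> M).
Hypothesis gC : is_qc_hom C N (omap g).

Definition word_prod (w : word Q) : M := (\prod_(x <- w) g x)%g.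

Lemma word_prod_cons x w : word_prod (x :: w) = (g x * word_prod w)%g.
Proof. by rewrite /word_prod big_cons. Qed.

(** Additivity of the weight on the product of 1 with itself gives [wt 1 = wt 1 + wt 1]. *)
Lemma qc_monoid_wt1 : wt N 1%g = 0.
Proof.
have [_ _ [_ H _ _]] := mN; have [] := H (1%g, 1%g) _ erefl.
by rewrite /= mul1g => /(congr1 (fun v => v - wt N 1%g)); rewrite subrr addrK.
Qed.

Lemma word_prod_values w :
  wt N (word_prod w) = wt (free_qc C) w /\
  forall i, eps N i (word_prod w) = eps (free_qc C) i w /\
            phi N i (word_prod w) = phi (free_qc C) i w.
Proof.
have [qN nN [_ mulN _ _]] := mN; have [_ gN _ _] := gC.
elim: w => [|x w [IHwt IHv]].
  rewrite /word_prod big_nil qc_monoid_wt1 /= big_nil; split => // i.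
  by rewrite /= !big_nil; exact: N1.
rewrite word_prod_cons; have [gwt gv] := gN x _ erefl.
have [mwt mv] := mulN (g x, word_prod w) _ erefl.
split; first by rewrite mwt /= big_cons gwt IHwt.
move=> i; have [mveps mvphi] := mv i; have [ge gp] := gv i.
have [IHe IHp] := IHv i.
(* Blocking depends only on [phi] of the left factor and [eps] of the right one, and both are
   preserved. *)
have bE : tensor_blocked N N i (g x, word_prod w)
        = tensor_blocked C (free_qc C) i (x, w).
  by rewrite /tensor_blocked /fst /snd gp IHe.
rewrite mveps mvphi free_eps_cons // free_phi_cons //.
by rewrite qtensor_epsE // qtensor_phiE // bE ge gp IHe IHp.
Qed.

Lemma word_prod_e i w v : e_ (free_qc C) i w = Some v ->
  e_ N i (word_prod w) = Some (word_prod v).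
Proof.
have [qN nN [_ _ mulE _]] := mN; have [_ gN gE _] := gC.
elim: w v => [|x w IHw] v //; rewrite free_e_cons //.
have [_ /(_ i)[_ gp]] := gN x _ erefl.
have [_ /(_ i)[we _]] := word_prod_values w.
case exw: (e_ _ i (x, w)) => [[y u]|] //= -[<-].
(* Multiplication is known to commute with [e_] only where [e_] is defined on the tensor, so
   definedness there comes first. *)
suff H : e_ (qtensor N N) i (g x, word_prod w) = Some (g y, word_prod u).
  by rewrite !word_prod_cons -(mulE _ _ _ _ _ H erefl erefl) H.
(* Both tensors now branch on the same conditions; [e_] acts on the tail by induction or on the head
   through [g]. *)
move: exw; rewrite !qtensor_eE ?gp ?qc_phi_ge0 // we.
case: ifP => _; [case: ifP => // _|].
  by case ew: (e_ _ i w) => [u'|] //= -[<- <-]; rewrite (IHw _ ew).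
by case ex: (e_ _ i x) => [y'|] //= -[<- <-];
   rewrite -(gE _ _ _ _ _ ex erefl erefl) ex.
Qed.

Lemma word_prod_f i w v : f_ (free_qc C) i w = Some v ->
  f_ N i (word_prod w) = Some (word_prod v).
Proof.
have [qN nN [_ _ _ mulF]] := mN; have [_ gN _ gF] := gC.
elim: w v => [|x w IHw] v //; rewrite free_f_cons //.
have [_ /(_ i)[_ gp]] := gN x _ erefl.
have [_ /(_ i)[we _]] := word_prod_values w.
case fxw: (f_ _ i (x, w)) => [[y u]|] //= -[<-].
suff H : f_ (qtensor N N) i (g x, word_prod w) = Some (g y, word_prod u).
  by rewrite !word_prod_cons -(mulF _ _ _ _ _ H erefl erefl) H.
move: fxw; rewrite !qtensor_fE ?we ?free_eps_ge0 // gp.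
case: ifP => _; [case: ifP => // _|].
  by case fx: (f_ _ i x) => [y'|] //= -[<- <-];
     rewrite -(gF _ _ _ _ _ fx erefl erefl) fx.
by case fw: (f_ _ i w) => [u'|] //= -[<- <-]; rewrite (IHw _ fw).
Qed.

Lemma word_prod_qc_monoid_hom : is_qc_monoid_hom (free_qc C) N word_prod.
Proof.
split; last first.
  split; first by rewrite /word_prod big_nil.
  by move=> u v; rewrite /word_prod big_cat.
split => //.
- by move=> w _ [<-]; exact: word_prod_values.
- by move=> i w v _ _ ew [<-] _; rewrite ew (word_prod_e ew).
- by move=> i w v _ _ fw [<-] _; rewrite fw (word_prod_f fw).
Qed.

End Extension.

(** * Existence and uniqueness of the extension *)

Theorem theorem6p13 (R : realType) (D : root_data R)
    (Q : choiceType) (C : qc_ops D Q) (M : monoidType) (N : qc_ops D M)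
    (psi : option Q -> option M) :
  is_quasicrystal C -> seminormal C ->
  is_qc_monoid N -> nondegenerate_qc N ->
  is_qc_hom C N psi -> (forall x : Q, exists m : M, psi (Some x) = Some m) ->
  exists! psihat : word Q -> M,
    is_qc_monoid_hom (free_qc C) N psihat /\
    forall x : Q, Some (psihat (letter x)) = psi (Some x).
Proof.
move=> qC nC mN N1 psiC /choice[g psig].
(* [psi] is defined on all of [Q] and fixes the undefined element, so it comes from a map [g] on
   elements. *)
have psiE : psi = omap g.
  by apply/funext => -[x|]; [exact: psig|have [-> _ _ _] := psiC].
rewrite {}psiE in psiC psig *.
exists (word_prod g); split.
  split; first exact: word_prod_qc_monoid_hom.
  by move=> x; rewrite /word_prod big_seq1.
(* A monoid morphism on words is determined by its values on letters. *)
move=> h [[_ [h1 hM]] hx]; apply/funext => w; elim: w => [|x w IHw].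
  by rewrite /word_prod big_nil h1.
have -> : (x :: w : word Q) = (letter x * w)%g by [].
by rewrite hM -IHw; have [->] := hx x; rewrite word_prod_cons.
Qed.
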